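(* Let $a_2\in S^2(\mathbb{R}^n\times\mathbb{R}^n)$ be non-negative ($a_2\ge 0$). Put $a(x,\xi)=a_2(x,\xi)+|x|^2$ and $m(x,\xi)=a(x,\xi)+\langle X\rangle$ for $X=(x,\xi)\in\mathbb{R}^n\times\mathbb{R}^n$, and define the Riemannian metric $g$ on $\mathbb{R}^n\times\mathbb{R}^n$ by $$g_X(dx,d\xi)=m^{-1}(x,\xi)\,(\langle\xi\rangle^2+|x|^2)\,dx^2+m^{-1}(x,\xi)\,d\xi^2 .$$ Then $g$ is a Hörmander metric.
   Context: Notation: $\langle\xi\rangle=(1+|\xi|^2)^{1/2}$, $\langle X\rangle=(1+|x|^2+|\xi|^2)^{1/2}$ for $X=(x,\xi)$. $S^2(\mathbb{R}^n\times\mathbb{R}^n)$ is the Kohn–Nirenberg class of smooth functions $b$ with $|\partial_x^\beta\partial_\xi^\alpha b(x,\xi)|\le C_{\alpha,\beta}(1+|\xi|)^{2-|\alpha|}$ for all multi-indices $\alpha,\beta$ and all $(x,\xi)$. For $T=(t,\tau)\in\mathbb{R}^n\times\mathbb{R}^n$, an expression $g_X=A(X)dx^2+B(X)d\xi^2$ means $g_X(T)=A(X)|t|^2+B(X)|\tau|^2$. Symplectic form: for $Y=(y,\eta)$, $Z=(z,\zeta)$, $\sigma(Y,Z)=\langle z,\eta\rangle-\langle y,\zeta\rangle$. For positive definite quadratic forms $g_X$ on $\mathbb{R}^{2n}$, $X\in\mathbb{R}^{2n}$, set $g_X^\sigma(T)=\sup_{W\ne0}\sigma(T,W)^2/g_X(W)$.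 The family $g$ is a Hörmander metric if: (i) (continuity) there is $C>0$ such that $g_X(X-Y)\le C^{-1}$ implies $(g_X(T)/g_Y(T))^{\pm1}\le C$ for all $X,Y$ and all $T\neq0$; (ii) (uncertainty principle) $\lambda_g(X)=\inf_{T\ne0}(g_X^\sigma(T)/g_X(T))^{1/2}\ge1$ for all $X$; (iii) (temperateness) there are $\overline C>0$ and $J\in\mathbb{N}$ such that $(g_X(T)/g_Y(T))^{\pm1}\le\overline C(1+g_Y^\sigma(X-Y))^J$ for all $X,Y$ and all $T\ne 0$. *)

(* Defs.v *)
From HB Require Import structures.
From mathcomp Require Import all_boot all_order all_algebra.
From mathcomp Require Import all_classical all_reals all_analysis.

Set Implicit Arguments.
Unset Strict Implicit.
Unset Printing Implicit Defensive.

Import Order.TTheory GRing.Theory Num.Theory.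
Import numFieldNormedType.Exports.

Local Open Scope classical_set_scope.
Local Open Scope ring_scope.

(* R^n x R^n, with points X = (x, xi): position first, frequency second. *)
Notation phase R n := ('rV[R]_n * 'rV[R]_n)%type.

(* The library norm of 'rV[R]_n is the sup norm, so the Euclidean structure
   is introduced separately; both norms define the same topology. *)
Definition dotp (R : realType) (n : nat) (x y : 'rV[R]_n) : R :=
  \sum_(i < n) x 0 i * y 0 i.

Definition enorm (R : realType) (n : nat) (x : 'rV[R]_n) : R :=
  Num.sqrt (dotp x x).

Definition bracket (R : realType) (n : nat) (xi : 'rV[R]_n) : R :=
  Num.sqrt (1 + enorm xi ^+ 2).

Definition bracketX (R : realType) (n : nat) (X : phase R n) : R :=
  Num.sqrt (1 + enorm X.1 ^+ 2 + enorm X.2 ^+ 2).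

Fixpoint Ck (R : realType) (V : normedModType R) (k : nat) (f : V -> R)
    : Prop :=
  match k with
  | 0 => continuous f
  | k'.+1 => (forall X, differentiable f X) /\
             (forall v, Ck k' (fun X => 'D_v f X))
  end.

Definition smooth (R : realType) (V : normedModType R) (f : V -> R) : Prop :=
  forall k, Ck k f.

Definition partial_x (R : realType) (n : nat) (i : 'I_n)
    (b : phase R n -> R) : phase R n -> R :=
  fun X => 'D_((delta_mx 0 i, 0) : phase R n) b X.

Definition partial_xi (R : realType) (n : nat) (i : 'I_n)
    (b : phase R n -> R) : phase R n -> R :=
  fun X => 'D_((0, delta_mx 0 i) : phase R n) b X.

Definition multi_index (n : nat) : Type := 'I_n -> nat.

Definition mi_size (n : nat) (al : multi_index n) : nat :=
  (\sum_(i < n) al i)%N.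

Definition mpartial_x (R : realType) (n : nat) (be : multi_index n)
    (b : phase R n -> R) : phase R n -> R :=
  foldr (fun i h => iter (be i) (partial_x i) h) b (enum 'I_n).

Definition mpartial_xi (R : realType) (n : nat) (al : multi_index n)
    (b : phase R n -> R) : phase R n -> R :=
  foldr (fun i h => iter (al i) (partial_xi i) h) b (enum 'I_n).

(* Real-valued elements of the Kohn-Nirenberg class S^mu. *)
Definition KN_class (R : realType) (n : nat) (mu : int)
    (b : phase R n -> R) : Prop :=
  smooth b /\
  forall al be : multi_index n, exists C : R, forall x xi : 'rV[R]_n,
    `| mpartial_x be (mpartial_xi al b) (x, xi) |
      <= C * (1 + enorm xi) ^ (mu - (mi_size al)%:Z).

(* A family of forms is a function g with g X T standing for g_X(T). *)

Definition pos_def_quadratic (R : realType) (V : lmodType R) (q : V -> R)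
    : Prop :=
  (exists B : V -> V -> R,
     [/\ forall Y, scalar (B Y),
         forall Y Z, B Y Z = B Z Y
       & forall T, q T = B T T]) /\
  (forall T, T != 0 -> 0 < q T).

Definition symp (R : realType) (n : nat) (Y Z : phase R n) : R :=
  dotp Z.1 Y.2 - dotp Y.1 Z.2.

Definition dual_form (R : realType) (n : nat)
    (g : phase R n -> phase R n -> R) (X T : phase R n) : \bar R :=
  ereal_sup [set (symp T W ^+ 2 / g X W)%:E | W in [set W | W != 0]].

Definition lambda (R : realType) (n : nat)
    (g : phase R n -> phase R n -> R) (X : phase R n) : \bar R :=
  ereal_inf
    [set sqrte (dual_form g X T / (g X T)%:E)%E | T in [set T | T != 0]].

Definition hcontinuous (R : realType) (n : nat)
    (g : phase R n -> phase R n -> R) : Prop :=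
  exists2 C : R, 0 < C &
    forall X Y : phase R n, g X (X - Y) <= C^-1 ->
    forall T : phase R n, T != 0 ->
      g X T / g Y T <= C /\ (g X T / g Y T)^-1 <= C.

Definition uncertainty (R : realType) (n : nat)
    (g : phase R n -> phase R n -> R) : Prop :=
  forall X : phase R n, (1 <= lambda g X)%E.

Definition temperate (R : realType) (n : nat)
    (g : phase R n -> phase R n -> R) : Prop :=
  exists2 C : R, 0 < C & exists J : nat,
    forall X Y T : phase R n, T != 0 ->
      ((g X T / g Y T)%R%:E <= C%:E * (1 + dual_form g Y (X - Y)%R) ^+ J)%E /\
      (((g X T / g Y T)^-1)%R%:E <= C%:E * (1 + dual_form g Y (X - Y)%R) ^+ J)%E.

Definition hormander_metric (R : realType) (n : nat)
    (g : phase R n -> phase R n -> R) : Prop :=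
  [/\ forall X, pos_def_quadratic (g X),
      hcontinuous g,
      uncertainty g
    & temperate g].

(* The metric A(X) dx^2 + B(X) dxi^2. *)
Definition diag_metric (R : realType) (n : nat) (A B : phase R n -> R)
    : phase R n -> phase R n -> R :=
  fun X T => A X * enorm T.1 ^+ 2 + B X * enorm T.2 ^+ 2.

(* Main.v *)
Require Import Defs.
From HB Require Import structures.
From mathcomp Require Import all_boot all_order all_algebra.
From mathcomp Require Import all_classical all_reals all_analysis.
From mathcomp Require Import ring lra.

Set Implicit Arguments.
Unset Strict Implicit.

Import Order.TTheory GRing.Theory Num.Theory.
Import numFieldNormedType.Exports.

Local Open Scope ring_scope.

(** Write [h = bracketX], [|.|] for the Euclidean norm, and [V = (v, w)] for a
    displacement.  The metric is [g_X = m^-1 (h^2 dx^2 + dxi^2)], because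
    [<xi>^2 + |x|^2 = h^2], and [m = a + h].

    The uncertainty principle is the inequality [h <= m]: for a diagonal form
    [A dx^2 + B dxi^2] it amounts to [A * B <= 1], here [(h / m)^2 <= 1].

    Both remaining conditions ask for control of [h_X / h_Y] and [m_X / m_Y].
    The ratio of the brackets is elementary, so all the work lies in [a], and
    everything about [a] follows from one estimate ([nonneg_variation]): for
    [|s| <= 1],
      [|a(X + sV) - a(X)| <= |s| c (a(X) + h_X^2 |v|^2 + |w|^2)].
    It is a form of the inequality [|f'|^2 <= 2 f sup |f''|] for nonnegative
    functions.  In one variable, [0 <= f(r)] and [0 <= f(-r)] together with
    Taylor's formula bound [|f'(0) r|] by [f(0) + K r^2], and hence the
    variation of [f] over the whole segment.  In several variables one moves
    along one coordinate at a time, so that everything reduces to the pure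
    second derivatives; each coordinate at most doubles the constant.  The
    [x]-coordinates move first, with [xi] frozen at its initial value, where the
    symbol class bounds the second [x]-derivatives by [K (1 + |xi|^2)]; the
    second [xi]-derivatives are bounded by a constant everywhere.  In this order
    the right-hand side only involves the bracket at the starting point.

    Continuity ([bracket_metric_continuous]): if [g_X(X - Y)] is small, then
    [h_X^2 |v|^2 + |w|^2] is a small multiple of [m_X = O(h_X^2)].  Applying the
    estimate to a large dilate of [X - Y] with a correspondingly small [s] gives
    [|a(Y) - a(X)| <= m_X / 4].

    Temperateness ([bracket_metric_temperate]): let [V = X - Y] and
    [D = 1 + m_Y (|v|^2 + |w|^2 / h_Y^2)], which is at most [1 + g_Y^sigma(V)].
    Then [h_Y^2 |v|^2 + |w|^2 <= (D - 1) h_Y^2 / m_Y <= (D - 1) h_Y].  This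
    gives [h_X <= 2 D h_Y] and [h_Y <= 2 D h_X], and the estimate with [s = 1],
    started from [Y] and from [X], bounds [m_X / m_Y] by [O(D)] and
    [m_Y / m_X] by [O(D^3)]. *)

(** * Nonnegative functions of one variable *)

(** The difference quotients of [f] along a line are literally those of the
    one-variable restriction. *)
Lemma is_derive_line (R : realType) (V : normedModType R) (f : V -> R)
    (P v : V) (r : R) :
  derivable f (P + r *: v) v ->
  is_derive r (1 : R) (fun s : R => f (P + s *: v)) ('D_v f (P + r *: v)).
Proof.
have E : (fun h : R => h^-1 *:
      (((fun s : R => f (P + s *: v)) \o shift r) (h *: (1 : R))
       - f (P + r *: v))) =
    (fun h : R => h^-1 *:
      ((f \o shift (P + r *: v)) (h *: v) - f (P + r *: v))).
  apply/funext => h /=; congr (_ *: (f _ - _)).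
  by rewrite [h *: 1]mulr1 scalerDl addrCA.
by move=> df; split; [rewrite /derivable E | rewrite /derive E].
Qed.

(** Stated for [s] of either sign, with the intermediate point located by its
    absolute value, so that it can be iterated. *)
Lemma mvt_origin (R : realType) (f df : R -> R) (s : R) :
  (forall x, is_derive x (1 : R) f (df x)) ->
  exists2 c, `|c| <= `|s| & f s - f 0 = df c * s.
Proof.
move=> fd.
have cf (a b : R) : {within `[a, b], continuous f}%classic.
  by apply: derivable_within_continuous => x _; have [] := fd x.
have [s0|s0] := leP 0 s.
  have [c] := @MVT_segment _ f df 0 s s0 (fun x _ => fd x) (cf _ _).
  rewrite in_itv /= => /andP[c0 cs] E; exists c; last by rewrite E subr0.
  by rewrite !ger0_norm.
have [c] := @MVT_segment _ f df s 0 (ltW s0) (fun x _ => fd x) (cf _ _).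
rewrite in_itv /= => /andP[cs c0] E; exists c.
  by rewrite !ler0_norm ?(ltW s0) // lerN2.
by rewrite -opprB E; ring.
Qed.

(** Two applications of the mean value theorem; this loses the factor [1 / 2]
    of Taylor's formula. *)
Lemma taylor1_le (R : realType) (f f1 f2 : R -> R) (K s : R) :
  (forall x, is_derive x (1 : R) f (f1 x)) ->
  (forall x, is_derive x (1 : R) f1 (f2 x)) ->
  (forall x, `|f2 x| <= K) ->
  `|f s - f 0 - f1 0 * s| <= K * s ^+ 2.
Proof.
move=> d1 d2 f2K.
have [c cs ->] := mvt_origin s d1.
have [e _ E] := mvt_origin c d2.
rewrite -mulrBl E !normrM -real_normK ?num_real// expr2 mulrA.
rewrite ler_wpM2r//; apply: ler_pM => //.
Qed.

(** Nonnegativity of [f] at [r] and at [- r] bounds [f1 0 * r] on both sides: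
    a nonnegative function with bounded second derivative cannot be steep where
    it is small. *)
Lemma nonneg_variation_1d (R : realType) (f f1 f2 : R -> R) (K r s : R) :
  (forall x, is_derive x (1 : R) f (f1 x)) ->
  (forall x, is_derive x (1 : R) f1 (f2 x)) ->
  (forall x, `|f2 x| <= K) -> (forall x, 0 <= f x) -> `|s| <= 1 ->
  `|f (s * r) - f 0| <= `|s| * (f 0 + 2 * K * r ^+ 2).
Proof.
move=> d1 d2 f2K f0 s1.
have T x := taylor1_le x d1 d2 f2K.
have K0 : 0 <= K by rewrite (le_trans _ (f2K 0)).
(* Taylor's formula at the two ends of the segment *)
have D : `|f1 0 * r| <= f 0 + K * r ^+ 2.
  move: (T r) (T (- r)) (f0 r) (f0 (- r)); rewrite sqrrN mulrN.
  rewrite !ler_norml => /andP[? ?] /andP[? ?] ? ?; apply/andP; split; lra.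
have : `|f (s * r) - f 0| <= K * (s * r) ^+ 2 + `|s| * `|f1 0 * r|.
  rewrite -normrM [s * (_ * _)]mulrCA -lerBlDr (le_trans _ (T (s * r)))//.
  exact: lerB_dist.
move=> /le_trans; apply.
have -> : (s * r) ^+ 2 = `|s| * `|s| * r ^+ 2.
  by rewrite exprMn -expr2 real_normK ?num_real.
have := ler_wpM2l (normr_ge0 s) D.
have : 0 <= `|s| * (K * r ^+ 2) * (1 - `|s|).
  apply: mulr_ge0; last by rewrite subr_ge0.
  by apply: mulr_ge0 => //; apply: mulr_ge0; rewrite ?sqr_ge0.
move: (`|s|) (`|f1 0 * r|) (f 0) (r ^+ 2) => s2 g F r2 h1 h2.
lra.
Qed.

(** After each elementary move [f + Q] has at most doubled, which produces the
    geometric sum [2 ^+ size l - 1]. *)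
Lemma variation_sum (R : realType) (V : lmodType R) (I : Type)
    (f : V -> R) (v : I -> V) (Q s : R) (l : seq I) (P : V) :
  (forall Z, 0 <= f Z) -> 0 <= Q ->
  (forall i Z, `|f (Z + s *: v i) - f Z| <= `|s| * (f Z + Q)) ->
  `|s| <= 1 ->
  `|f (P + s *: \sum_(i <- l) v i) - f P|
    <= `|s| * ((2 ^+ size l - 1) * (f P + Q)).
Proof.
move=> f0 Q0 step s1; elim: l => [|i l IH].
  by rewrite big_nil scaler0 addr0 !subrr mul0r mulr0 normr0.
rewrite big_cons scalerDr [_ + s *: _]addrC addrA /=.
set Z := P + _ in IH *.
have := step i Z; move: IH; rewrite exprS.
have : 1 <= 2 ^+ size l :> R by rewrite exprn_ege1 ?ler1n.
move: (2 ^+ size l) => N N1 IH st.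
have -> : f (Z + s *: v i) - f P = (f (Z + s *: v i) - f Z) + (f Z - f P).
  by rewrite addrA subrK.
apply: (le_trans (ler_normD _ _)); apply: (le_trans (lerD st IH)).
rewrite -mulrDr ler_wpM2l//.
have : f Z - f P <= (N - 1) * (f P + Q).
  apply: (le_trans (ler_norm _)); apply: (le_trans IH).
  by rewrite ler_piMl// mulr_ge0 ?subr_ge0// addr_ge0.
lra.
Qed.

(** * Euclidean forms and the bracket *)

Lemma dotp_ge0 (R : realType) (n : nat) (x : 'rV[R]_n) : 0 <= dotp x x.
Proof. by apply: sumr_ge0 => i _; rewrite -expr2 sqr_ge0. Qed.

Lemma enorm_sqr (R : realType) (n : nat) (x : 'rV[R]_n) :
  enorm x ^+ 2 = dotp x x.
Proof. by rewrite sqr_sqrtr// dotp_ge0. Qed.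

Lemma coord_sqr_le (R : realType) (n : nat) (x : 'rV[R]_n) (i : 'I_n) :
  x 0 i ^+ 2 <= dotp x x.
Proof.
rewrite /dotp (bigD1 i)//= -expr2 lerDl; apply: sumr_ge0 => j _.
by rewrite -expr2 sqr_ge0.
Qed.

Lemma dotp_line (R : realType) (n : nat) (x t : 'rV[R]_n) (s : R) :
  dotp (x + s *: t) (x + s *: t)
    = dotp x x + 2 * s * dotp x t + s ^+ 2 * dotp t t.
Proof.
rewrite /dotp !mulr_sumr -!big_split; apply: eq_bigr => i _ /=.
by rewrite !mxE; ring.
Qed.

(** Both signs come from the nonnegativity of [|x +- t / e|^2]. *)
Lemma dotp_young (R : realType) (n : nat) (x t : 'rV[R]_n) (e : R) :
  0 < e -> `|2 * dotp x t| <= e * dotp x x + e^-1 * dotp t t.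
Proof.
move=> e0; have := dotp_ge0 (x + e^-1 *: t); have := dotp_ge0 (x + (- e^-1) *: t).
rewrite !dotp_line => h1 h2.
have := mulr_ge0 (ltW e0) h1; have := mulr_ge0 (ltW e0) h2.
have -> : e^-1 * dotp t t = e * (e^-1 ^+ 2 * dotp t t) by field; lra.
rewrite !mulrDr !sqrrN.
have -> : e * (2 * e^-1 * dotp x t) = 2 * dotp x t by field; lra.
have -> : e * (2 * (- e^-1) * dotp x t) = - (2 * dotp x t) by field; lra.
rewrite ler_norml => *; apply/andP; split; lra.
Qed.

Lemma dotpZ (R : realType) (n : nat) (k : R) (t : 'rV[R]_n) :
  dotp (k *: t) (k *: t) = k ^+ 2 * dotp t t.
Proof.
by rewrite /dotp mulr_sumr; apply: eq_bigr => i _; rewrite !mxE; ring.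
Qed.

Lemma dotp0l (R : realType) (n : nat) (x : 'rV[R]_n) : dotp 0 x = 0.
Proof. by apply: big1 => i _; rewrite mxE mul0r. Qed.

Lemma dotp0r (R : realType) (n : nat) (x : 'rV[R]_n) : dotp x 0 = 0.
Proof. by apply: big1 => i _; rewrite mxE mulr0. Qed.

Lemma dotp_gt0 (R : realType) (n : nat) (x : 'rV[R]_n) :
  x != 0 -> 0 < dotp x x.
Proof.
move=> /eqP x0; rewrite lt_neqAle dotp_ge0 andbT eq_sym.
apply/eqP => q0; apply: x0; apply/rowP => i; rewrite mxE.
have := coord_sqr_le x i; rewrite q0 => /(conj (sqr_ge0 (x 0 i)))/andP.
by rewrite -eq_le eq_sym sqrf_eq0 => /eqP.
Qed.

Lemma bracketX_sqr (R : realType) (n : nat) (X : phase R n) :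
  bracketX X ^+ 2 = 1 + dotp X.1 X.1 + dotp X.2 X.2.
Proof.
by rewrite sqr_sqrtr ?enorm_sqr// !addr_ge0 ?dotp_ge0.
Qed.

Lemma bracketX_ge1 (R : realType) (n : nat) (X : phase R n) :
  1 <= bracketX X.
Proof.
rewrite -[leLHS]sqrtr1 ler_wsqrtr// !enorm_sqr.
by have := dotp_ge0 X.1; have := dotp_ge0 X.2; lra.
Qed.

Lemma bracketX_shift (R : realType) (n : nat) (X V : phase R n) (e : R) :
  0 < e ->
  `|bracketX (X - V) ^+ 2 - bracketX X ^+ 2|
    <= e * bracketX X ^+ 2 + (1 + e^-1) * (dotp V.1 V.1 + dotp V.2 V.2).
Proof.
move=> e0; have sh (x v : 'rV[R]_n) :
    dotp (x - v) (x - v) = dotp x x - 2 * dotp x v + dotp v v.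
  by rewrite -[- v]scaleN1r dotp_line; ring.
rewrite !bracketX_sqr /= !sh.
have := dotp_young X.1 V.1 e0; have := dotp_young X.2 V.2 e0.
have := dotp_ge0 V.1; have := dotp_ge0 V.2.
rewrite !ler_norml => ? ? /andP[? ?] /andP[? ?]; apply/andP; split; lra.
Qed.

(** * Variation of nonnegative symbols *)

(** Along the path that changes one coordinate at a time, only the pure second
    partial derivatives [f2 i] intervene. *)
Lemma nonneg_variation_Rn (R : realType) (n : nat) (f : 'rV[R]_n -> R)
    (f1 f2 : 'I_n -> 'rV[R]_n -> R) (K s : R) (x t : 'rV[R]_n) :
  (forall i z (r : R),
    is_derive r (1 : R) (fun r => f (z + r *: delta_mx 0 i))
                        (f1 i (z + r *: delta_mx 0 i))) ->
  (forall i z (r : R),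
    is_derive r (1 : R) (fun r => f1 i (z + r *: delta_mx 0 i))
                        (f2 i (z + r *: delta_mx 0 i))) ->
  (forall i z, `|f2 i z| <= K) -> 0 <= K -> (forall z, 0 <= f z) ->
  `|s| <= 1 ->
  `|f (x + s *: t) - f x| <= `|s| * (2 ^+ n * (f x + 2 * K * dotp t t)).
Proof.
move=> d1 d2 f2K K0 f0 s1.
have Q0 : 0 <= 2 * K * dotp t t by rewrite !mulr_ge0 ?dotp_ge0.
rewrite [in f (x + _)](row_sum_delta t).
have step i z : `|f (z + s *: (t 0 i *: delta_mx 0 i)) - f z|
    <= `|s| * (f z + 2 * K * dotp t t).
  have := @nonneg_variation_1d _ _ _ _ K (t 0 i) s (d1 i z) (d2 i z)
    (fun=> f2K _ _) (fun=> f0 _) s1.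
  rewrite scalerA scale0r addr0 => /le_trans; apply.
  by rewrite ler_wpM2l// lerD2l ler_wpM2l ?coord_sqr_le// mulr_ge0.
have := @variation_sum _ _ _ f _ _ s (index_enum 'I_n) x f0 Q0 step s1.
have -> : size (index_enum 'I_n) = n by rewrite -[index_enum _]enumT size_enum_ord.
move=> /le_trans; apply.
by rewrite ler_wpM2l// ler_wpM2r ?addr_ge0// gerBl.
Qed.

Lemma foldr_iter_single (T : Type) (n : nat) (F : 'I_n -> T -> T) (k : nat)
    (i : 'I_n) (b : T) (l : seq 'I_n) : uniq l ->
  foldr (fun j h => iter (if j == i then k else 0%N) (F j) h) b l
    = if i \in l then iter k (F i) b else b.
Proof.
elim: l => //= j l IH /andP[jl /IH ->]; rewrite inE.
by have [<-|//] := eqVneq j i; rewrite (negPf jl).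
Qed.

Definition mi_single (n : nat) (i : 'I_n) (k : nat) : multi_index n :=
  fun j => if j == i then k else 0%N.

Lemma mpartial_x_single (R : realType) (n : nat) (i : 'I_n) (k : nat)
    (b : phase R n -> R) :
  mpartial_x (mi_single i k) b = iter k (partial_x i) b.
Proof. by rewrite /mpartial_x foldr_iter_single ?enum_uniq// mem_enum. Qed.

Lemma mpartial_xi_single (R : realType) (n : nat) (i : 'I_n) (k : nat)
    (b : phase R n -> R) :
  mpartial_xi (mi_single i k) b = iter k (partial_xi i) b.
Proof. by rewrite /mpartial_xi foldr_iter_single ?enum_uniq// mem_enum. Qed.

Lemma mpartial_x0 (R : realType) (n : nat) (b : phase R n -> R) :
  mpartial_x (fun=> 0%N) b = b.
Proof. by rewrite /mpartial_x; elim: (enum _) => //= ? ? ->. Qed.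

Lemma mpartial_xi0 (R : realType) (n : nat) (b : phase R n -> R) :
  mpartial_xi (fun=> 0%N) b = b.
Proof. by rewrite /mpartial_xi; elim: (enum _) => //= ? ? ->. Qed.

Lemma mi_size_single (n : nat) (i : 'I_n) (k : nat) :
  mi_size (mi_single i k) = k.
Proof.
rewrite /mi_size (bigD1 i)//= /mi_single eqxx big1 ?addn0// => j /negPf ->//.
Qed.

Lemma mi_size0 (n : nat) : mi_size ((fun=> 0%N) : multi_index n) = 0%N.
Proof. by rewrite /mi_size big1. Qed.

(** The only seminorms of the symbol class that the proof uses, with a common
    constant and with [(1 + |xi|)^2] replaced by the comparable [1 + |xi|^2]. *)
Lemma KN2_bounds (R : realType) (n : nat) (b : phase R n -> R) :
  KN_class 2 b ->
  exists K : R,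
  [/\ 1 <= K, forall X, `|b X| <= K * (1 + dotp X.2 X.2),
      forall i X, `|partial_x i (partial_x i b) X| <= K * (1 + dotp X.2 X.2)
    & forall i X, `|partial_xi i (partial_xi i b) X| <= K].
Proof.
move=> [_ H].
have sq (C : R) (xi : 'rV[R]_n) :
    C * (1 + enorm xi) ^+ 2 <= 2 * `|C| * (1 + dotp xi xi).
  apply: (@le_trans _ _ (`|C| * (1 + enorm xi) ^+ 2)).
    by rewrite ler_wpM2r ?sqr_ge0// ler_norm.
  rewrite [2 * _]mulrC -mulrA ler_wpM2l// -enorm_sqr.
  have := sqr_ge0 (1 - enorm xi); move: (enorm xi) => e; lra.
have [C0 HC0] := H (fun=> 0%N) (fun=> 0%N).
have /choice[Cx HCx] : forall i : 'I_n, exists C : R, forall x xi,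
    `|partial_x i (partial_x i b) (x, xi)| <= C * (1 + enorm xi) ^+ 2.
  move=> i; have [C HC] := H (fun=> 0%N) (mi_single i 2); exists C => x xi.
  by have := HC x xi; rewrite mpartial_xi0 mpartial_x_single mi_size0.
have /choice[Cxi HCxi] : forall i : 'I_n, exists C : R, forall x xi,
    `|partial_xi i (partial_xi i b) (x, xi)| <= C.
  move=> i; have [C HC] := H (mi_single i 2) (fun=> 0%N); exists C => x xi.
  by have := HC x xi; rewrite mpartial_x0 mpartial_xi_single mi_size_single
    subrr expr0z mulr1.
have sum_ge (F : 'I_n -> R) i : `|F i| <= \sum_j `|F j|.
  by rewrite (bigD1 i)//= lerDl sumr_ge0.
have sum_ge0 (F : 'I_n -> R) : 0 <= \sum_j `|F j| by rewrite sumr_ge0.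
have Sx0 := sum_ge0 Cx; have Sxi0 := sum_ge0 Cxi; have C0' := normr_ge0 C0.
have q0 (X : phase R n) : 0 <= 1 + dotp X.2 X.2 by rewrite addr_ge0 ?dotp_ge0.
exists (1 + 2 * `|C0| + 2 * (\sum_j `|Cx j|) + \sum_j `|Cxi j|).
split.
- lra.
- move=> [x xi]; have := HC0 x xi; rewrite mpartial_xi0 mpartial_x0 mi_size0.
  move=> /le_trans; apply; apply: le_trans (sq _ _) _.
  by rewrite ler_wpM2r ?(q0 (x, xi))//; lra.
- move=> i [x xi]; have := HCx i x xi.
  move=> /le_trans; apply; apply: le_trans (sq _ _) _.
  rewrite ler_wpM2r ?(q0 (x, xi))//; have := sum_ge Cx i; lra.
- move=> i [x xi]; have := HCxi i x xi.
  move=> /le_trans; apply; apply: le_trans (ler_norm _) _.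
  have := sum_ge Cxi i; lra.
Qed.

(** The [x]-coordinates move first: the factor [1 + |xi|^2] is then evaluated
    at the starting point.  In the opposite order it would be evaluated at the
    final frequency, which the right-hand side does not control. *)
Lemma nonneg_symbol_variation (R : realType) (n : nat) (b : phase R n -> R)
    (K : R) :
  smooth b -> (forall X, 0 <= b X) -> 0 <= K ->
  (forall i X, `|partial_x i (partial_x i b) X| <= K * (1 + dotp X.2 X.2)) ->
  (forall i X, `|partial_xi i (partial_xi i b) X| <= K) ->
  exists2 c : R, 0 <= c & forall (X T : phase R n) (s : R), `|s| <= 1 ->
    `|b (X + s *: T) - b X|
      <= `|s| * (c * (b X + (1 + dotp X.2 X.2) * dotp T.1 T.1
                      + dotp T.2 T.2)).
Proof.
move=> bs b0 K0 Kx Kxi; have [/= b_diff Db_diff] := bs 2%N.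
pose N : R := 2 ^+ n.
have N0 : 0 <= N by rewrite exprn_ge0.
exists ((2 * N + N ^+ 2) * (1 + 2 * K)); first by nra.
move=> [x xi] [t tau] s s1 /=.
have ex i (z : 'rV[R]_n) (r : R) :
    ((z, xi) : phase R n) + r *: ((delta_mx 0 i, 0) : phase R n)
      = (z + r *: delta_mx 0 i, xi).
  by congr (_, _); rewrite /= scaler0 addr0.
have exi y i (z : 'rV[R]_n) (r : R) :
    ((y, z) : phase R n) + r *: ((0, delta_mx 0 i) : phase R n)
      = (y, z + r *: delta_mx 0 i).
  by congr (_, _); rewrite /= scaler0 addr0.
have q0 : 0 <= 1 + dotp xi xi by rewrite addr_ge0 ?dotp_ge0.
have dx (h : phase R n -> R) i z r : (forall X, differentiable h X) ->
    is_derive r (1 : R) (fun r => h (z + r *: delta_mx 0 i, xi))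
                        (partial_x i h (z + r *: delta_mx 0 i, xi)).
  move=> hd.
  have := @is_derive_line _ _ h (z, xi) (delta_mx 0 i, 0) r
    (diff_derivable (hd _)).
  by rewrite ex; under eq_fun do rewrite ex.
have dxi (h : phase R n -> R) y i z r : (forall X, differentiable h X) ->
    is_derive r (1 : R) (fun r => h (y, z + r *: delta_mx 0 i))
                        (partial_xi i h (y, z + r *: delta_mx 0 i)).
  move=> hd.
  have := @is_derive_line _ _ h (y, z) (0, delta_mx 0 i) r
    (diff_derivable (hd _)).
  by rewrite exi; under eq_fun do rewrite exi.
have stepx := @nonneg_variation_Rn _ _ (fun z => b (z, xi))
    (fun i z => partial_x i b (z, xi))
    (fun i z => partial_x i (partial_x i b) (z, xi))
    (K * (1 + dotp xi xi)) s x t (fun i z r => dx b i z r b_diff)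
    (fun i z r => dx (partial_x i b) i z r (Db_diff _).1)
    (fun i z => Kx i (z, xi)) (mulr_ge0 K0 q0) (fun z => b0 (z, xi)) s1.
have stepxi := @nonneg_variation_Rn _ _ (fun z => b (x + s *: t, z))
    (fun i z => partial_xi i b (x + s *: t, z))
    (fun i z => partial_xi i (partial_xi i b) (x + s *: t, z))
    K s xi tau (fun i z r => dxi b _ i z r b_diff)
    (fun i z r => dxi (partial_xi i b) _ i z r (Db_diff _).1)
    (fun i z => Kxi i (x + s *: t, z)) K0 (fun z => b0 (x + s *: t, z)) s1.
rewrite /= -/N in stepx stepxi.
have -> : ((x, xi) : phase R n) + s *: ((t, tau) : phase R n)
    = (x + s *: t, xi + s *: tau) by [].
have p1 := b0 (x, xi); have p2 := dotp_ge0 tau.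
have p3 : 0 <= (1 + dotp xi xi) * dotp t t by rewrite mulr_ge0 ?dotp_ge0.
move: stepx stepxi p1 p2 p3.
have -> : 2 * (K * (1 + dotp xi xi)) * dotp t t
  = 2 * K * ((1 + dotp xi xi) * dotp t t) by ring.
move: (b (x, xi)) (b (x + s *: t, xi)) (b (x + s *: t, xi + s *: tau))
  (dotp tau tau) ((1 + dotp xi xi) * dotp t t).
move=> B0 B1 B2 u w st1 st2 p1 p2 p3.
have -> : B2 - B0 = (B2 - B1) + (B1 - B0) by ring.
apply: (le_trans (ler_normD _ _)); apply: (le_trans (lerD st2 st1)).
rewrite -mulrDr ler_wpM2l//.
set F := B0 + 2 * K * w in st1 *.
have F0 : 0 <= F by rewrite addr_ge0 ?mulr_ge0.
have B1F : B1 <= (1 + N) * F.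
  have : B1 - B0 <= N * F.
    apply: (le_trans (ler_norm _)); apply: (le_trans st1).
    by rewrite ler_piMl// mulr_ge0.
  have : B0 <= F by rewrite lerDl !mulr_ge0.
  lra.
have FG : F <= (1 + 2 * K) * (B0 + w) by rewrite /F; nra.
have h1 : N * B1 <= N * (1 + N) * F by rewrite -mulrA ler_wpM2l.
have h2 : (2 * N + N ^+ 2) * F
    <= (2 * N + N ^+ 2) * ((1 + 2 * K) * (B0 + w)).
  by rewrite ler_wpM2l// !(sqr_ge0, addr_ge0, mulr_ge0).
have h3 : 0 <= (N + N ^+ 2) * (1 + 2 * K) * u + N * u.
  by rewrite !(sqr_ge0, addr_ge0, mulr_ge0).
rewrite mulrDr; lra.
Qed.

(** The last two terms are [h_X^2 dx^2 + dxi^2] evaluated at [T], i.e. the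
    bracket metric without its conformal factor. *)
Definition nonneg_variation (R : realType) (n : nat) (a : phase R n -> R)
    (c : R) : Prop :=
  forall (X T : phase R n) (s : R), `|s| <= 1 ->
    `|a (X + s *: T) - a X|
      <= `|s| * (c * (a X + bracketX X ^+ 2 * dotp T.1 T.1 + dotp T.2 T.2)).

(** Adding [|x|^2] to the symbol is harmless, because it satisfies a variation
    estimate of the same form by Young's inequality. *)
Lemma KN2_nonneg_variation (R : realType) (n : nat) (a2 : phase R n -> R) :
  KN_class 2 a2 -> (forall X, 0 <= a2 X) ->
  exists c K : R, [/\ 1 <= c, 1 <= K,
    nonneg_variation (fun X => a2 X + dotp X.1 X.1) c
    & forall X, a2 X + dotp X.1 X.1 <= K * bracketX X ^+ 2].
Proof.
move=> a2_S2 a0; have [K [K1 aK Kx Kxi]] := KN2_bounds a2_S2.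
have K0 : 0 <= K by lra.
have [c c0 var] := nonneg_symbol_variation a2_S2.1 a0 K0 Kx Kxi.
exists (c + 2), (K + 1); split; try lra.
- move=> X T s s1; have := var X T s s1.
  set Z := X + s *: T.
  have -> : dotp Z.1 Z.1 = dotp X.1 X.1 + 2 * s * dotp X.1 T.1
      + s ^+ 2 * dotp T.1 T.1 by rewrite -dotp_line.
  have := dotp_young X.1 T.1 ltr01; rewrite invr1 !mul1r bracketX_sqr.
  have := a0 X; have := dotp_ge0 X.1; have := dotp_ge0 X.2.
  have := dotp_ge0 T.1; have := dotp_ge0 T.2.
  move: (a2 Z) (a2 X) (dotp X.1 X.1) (dotp X.2 X.2) (dotp X.1 T.1)
    (dotp T.1 T.1) (dotp T.2 T.2) => b' b x xi d t tau t0 tau0 xi0 x0 b0 yd h.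
  have -> : b' + (x + 2 * s * d + s ^+ 2 * t) - (b + x)
    = (b' - b) + (s * (2 * d) + s ^+ 2 * t) by ring.
  apply: (le_trans (ler_normD _ _)).
  have h2 : `|s * (2 * d) + s ^+ 2 * t| <= `|s| * (x + 2 * t).
    apply: (le_trans (ler_normD _ _)).
    have -> : `|s ^+ 2 * t| = `|s| * (`|s| * t).
      by rewrite normrM (ger0_norm tau0) normrX expr2 mulrA.
    rewrite normrM -mulrDr ler_wpM2l//.
    have : `|s| * t <= t by rewrite ler_piMl.
    lra.
  apply: (le_trans (lerD h h2)); rewrite -mulrDr ler_wpM2l//.
  have m1 : 0 <= x * t by rewrite mulr_ge0.
  have m2 : 0 <= xi * t by rewrite mulr_ge0.
  have m3 : 0 <= c * (x * t) by rewrite mulr_ge0.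
  have m4 : 0 <= c * x by rewrite mulr_ge0.
  lra.
- move=> X; have := le_trans (ler_norm _) (aK X); rewrite bracketX_sqr.
  have := dotp_ge0 X.1; have := dotp_ge0 X.2 => x0 xi0 h.
  have := mulr_ge0 K0 xi0; lra.
Qed.

(** * Diagonal metrics and their symplectic duals *)

Lemma diag_form_gt0 (R : realType) (n : nat) (A B : R) (T : phase R n) :
  0 < A -> 0 < B -> T != 0 -> 0 < A * dotp T.1 T.1 + B * dotp T.2 T.2.
Proof.
case: T => t tau A0 B0 /= T0.
have [t0|/dotp_gt0 q] := eqVneq t 0; last first.
  by rewrite ltr_wpDr ?mulr_gt0// mulr_ge0 ?dotp_ge0// ltW.
have [u0|/dotp_gt0 q] := eqVneq tau 0; first by rewrite t0 u0 eqxx in T0.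
by rewrite ltr_wpDl ?mulr_gt0// mulr_ge0 ?dotp_ge0// ltW.
Qed.

Lemma diag_metricE (R : realType) (n : nat) (A B : phase R n -> R)
    (X T : phase R n) :
  diag_metric A B X T = A X * dotp T.1 T.1 + B X * dotp T.2 T.2.
Proof. by rewrite /diag_metric !enorm_sqr. Qed.

Lemma diag_metric_pos_def (R : realType) (n : nat) (A B : phase R n -> R)
    (X : phase R n) :
  0 < A X -> 0 < B X -> pos_def_quadratic (diag_metric A B X).
Proof.
move=> A0 B0; split; last first.
  by move=> T T0; rewrite diag_metricE diag_form_gt0.
exists (fun Y Z => A X * dotp Y.1 Z.1 + B X * dotp Y.2 Z.2); split.
- move=> Y k U V /=; rewrite /dotp !mulr_sumr -!big_split mulr_sumr -big_split.
  by apply: eq_bigr => i _ /=; rewrite !mxE; ring.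
- move=> Y Z; congr (_ * _ + _ * _); apply: eq_bigr => i _; exact: mulrC.
- by move=> T; rewrite diag_metricE.
Qed.

(** The dual of [A dx^2 + B dxi^2] under the symplectic form: position and
    frequency are exchanged. *)
Definition diag_dual (R : realType) (n : nat) (A B : R) (T : phase R n) : R :=
  B^-1 * dotp T.1 T.1 + A^-1 * dotp T.2 T.2.

(** The supremum that defines the dual form is attained at
    [W = (tau / A, - t / B)], by Cauchy-Schwarz; evaluating the quotient there
    gives this lower bound.  The vector [S] witnesses [n > 0]: in dimension
    zero the supremum is over the empty set. *)
Lemma diag_dual_le (R : realType) (n : nat) (A B : phase R n -> R)
    (X T S : phase R n) : S != 0 -> 0 < A X -> 0 < B X ->
  ((diag_dual (A X) (B X) T)%:E <= dual_form (diag_metric A B) X T)%E.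
Proof.
move=> S0 A0 B0; have [->|T0] := eqVneq T 0.
  apply: ereal_sup_ubound; exists S => //.
  congr (_%:E); rewrite /diag_dual /symp.
  by rewrite /= !dotp0l dotp0r subr0 expr0n mul0r !mulr0 addr0.
pose W : phase R n := ((A X)^-1 *: T.2, - (B X)^-1 *: T.1).
have dZl (k : R) (u v : 'rV[R]_n) : dotp (k *: u) v = k * dotp u v.
  by rewrite /dotp mulr_sumr; apply: eq_bigr => i _; rewrite mxE mulrA.
have dZr (k : R) (u v : 'rV[R]_n) : dotp u (k *: v) = k * dotp u v.
  by rewrite /dotp mulr_sumr; apply: eq_bigr => i _; rewrite mxE mulrCA.
have sW : symp T W = diag_dual (A X) (B X) T.
  by rewrite /symp /= dZl dZr /diag_dual; ring.
have gW : diag_metric A B X W = diag_dual (A X) (B X) T.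
  rewrite diag_metricE /= !dotpZ /diag_dual; field.
  by rewrite !gt_eqF.
have Q0 : 0 < diag_dual (A X) (B X) T.
  by apply: diag_form_gt0; rewrite ?invr_gt0.
apply: ereal_sup_ubound; exists W.
  apply/eqP => W0; move: gW; rewrite W0 diag_metricE.
  by rewrite !dotp0l !mulr0 addr0 => E; rewrite -E ltxx in Q0.
by rewrite sW gW expr2 -mulrA mulfV ?mulr1// gt_eqF.
Qed.

Lemma diag_uncertainty (R : realType) (n : nat) (A B : phase R n -> R) :
  (forall X, 0 < A X) -> (forall X, 0 < B X) -> (forall X, A X * B X <= 1) ->
  uncertainty (diag_metric A B).
Proof.
move=> A0 B0 AB X; apply: le_ereal_inf_tmp => _ [T T0 <-].
have gT0 : 0 < diag_metric A B X T by rewrite diag_metricE diag_form_gt0.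
have -> : (1 : \bar R)%E = sqrte 1%E by rewrite /= sqrtr1.
have gd : ((diag_metric A B X T)%:E <= dual_form (diag_metric A B) X T)%E.
  apply: le_trans (diag_dual_le T T0 (A0 X) (B0 X)); rewrite lee_fin diag_metricE.
  rewrite /diag_dual lerD// ler_wpM2r ?dotp_ge0//.
    by rewrite -[_^-1]mul1r ler_pdivlMr.
  by rewrite -[_^-1]mul1r ler_pdivlMr// mulrC.
have h : (1 <= dual_form (diag_metric A B) X T / (diag_metric A B X T)%:E)%E.
  by rewrite inver gt_eqF// lee_pdivlMr// mul1e.
by rewrite lee_sqrt// (le_trans _ h).
Qed.

(** * Metrics with weight a + <X> *)

Definition bracket_metric (R : realType) (n : nat) (m : phase R n -> R)
    : phase R n -> phase R n -> R :=
  diag_metric (fun X => (m X)^-1 * bracketX X ^+ 2) (fun X => (m X)^-1).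

Lemma bracket_metricE (R : realType) (n : nat) (m : phase R n -> R)
    (X T : phase R n) :
  bracket_metric m X T
    = (m X)^-1 * (bracketX X ^+ 2 * dotp T.1 T.1 + dotp T.2 T.2).
Proof. by rewrite /bracket_metric diag_metricE /=; ring. Qed.

(** Two factors [L] come from [bracketX ^+ 2] and one from the weight. *)
Lemma bracket_metric_ratio (R : realType) (n : nat) (m : phase R n -> R)
    (X Y T : phase R n) (L : R) :
  (forall Z, 0 < m Z) -> 1 <= L -> m Y <= L * m X ->
  bracketX X <= L * bracketX Y -> T != 0 ->
  bracket_metric m X T / bracket_metric m Y T <= L ^+ 3.
Proof.
move=> m0 L1 mYX hXY T0.
have h0 (Z : phase R n) : 0 < bracketX Z by apply: lt_le_trans (bracketX_ge1 Z).
have L0 : 0 < L by apply: lt_le_trans L1.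
rewrite ler_pdivrMr; last first.
  rewrite /bracket_metric diag_metricE; apply: diag_form_gt0 => //=.
    by apply: mulr_gt0; rewrite ?invr_gt0 ?exprn_gt0.
  by rewrite invr_gt0.
rewrite /bracket_metric !diag_metricE /= mulrDr ![L ^+ 3 * (_ * _)]mulrA.
have mV : (m X)^-1 <= L * (m Y)^-1.
  by rewrite -[leLHS]mul1r ler_pdivrMr// mulrAC ler_pdivlMr// mul1r.
have mV0 : 0 <= (m Y)^-1 by rewrite invr_ge0 ltW.
have L2 : 1 <= L ^+ 2 by rewrite exprn_ege1.
have hh : bracketX X ^+ 2 <= L ^+ 2 * bracketX Y ^+ 2.
  rewrite -exprMn ler_sqr ?nnegrE ?mulr_ge0 ?(ltW (h0 _))//; exact: ltW.
rewrite lerD// ler_wpM2r ?dotp_ge0//.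
  have -> : L ^+ 3 * (m Y)^-1 * bracketX Y ^+ 2
      = (L * (m Y)^-1) * (L ^+ 2 * bracketX Y ^+ 2) by ring.
  by apply: ler_pM => //; rewrite ?sqr_ge0 ?invr_ge0 ?(ltW (m0 _)).
apply: (le_trans mV); rewrite ler_wpM2r// -[leLHS]mulr1 exprS.
by rewrite ler_wpM2l// ltW.
Qed.

(** The constant [64 c^2 (K + 1)] makes [h_X^2 |v|^2 + |w|^2] both at most
    [m X / (64 c^2)], which controls the variation of [a], and at most
    [h_X^2 / 64], which controls the variation of the bracket. *)
Lemma bracket_metric_continuous (R : realType) (n : nat) (a : phase R n -> R)
    (c K : R) :
  (forall X, 0 <= a X) -> 1 <= c -> nonneg_variation a c ->
  1 <= K -> (forall X, a X <= K * bracketX X ^+ 2) ->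
  hcontinuous (bracket_metric (fun X => a X + bracketX X)).
Proof.
move=> a0 c1 var K1 aK; pose m := fun X : phase R n => a X + bracketX X.
rewrite -/m.
have h1 := @bracketX_ge1 R n.
have m0 X : 0 < m X by rewrite /m; have := a0 X; have := h1 X; lra.
have c0 : 0 < c by lra.
have C0 : 0 < 64 * c ^+ 2 * (K + 1) by rewrite !mulr_gt0 ?exprn_gt0//; lra.
exists (64 * c ^+ 2 * (K + 1)) => // X Y gXY T T0.
set V := X - Y in gXY.
have YE : Y = X - V by rewrite /V opprB addrC subrK.
set E := bracketX X ^+ 2 * dotp V.1 V.1 + dotp V.2 V.2.
have E0 : 0 <= E.
  by apply: addr_ge0; [apply: mulr_ge0; rewrite ?sqr_ge0|]; rewrite ?dotp_ge0.
have Em : 64 * c ^+ 2 * (K + 1) * E <= m X.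
  move: gXY; rewrite bracket_metricE -/E mulrC ler_pdivrMr//.
  by rewrite mulrC ler_pdivlMr// mulrC.
have c21 : 1 <= c ^+ 2 by rewrite exprn_ege1.
have Em1 : 64 * c ^+ 2 * E <= m X.
  apply: le_trans Em; rewrite ler_wpM2r// ler_peMr ?mulr_ge0 ?sqr_ge0//; lra.
have hsq : bracketX X <= bracketX X ^+ 2 by rewrite expr2 ler_peMl//; have := h1 X; lra.
have Eh : 64 * E <= bracketX X ^+ 2.
  have mK : m X <= (K + 1) * bracketX X ^+ 2.
    by rewrite /m mulrDl mul1r lerD.
  have : (K + 1) * (64 * E) <= (K + 1) * bracketX X ^+ 2.
    apply: le_trans mK; apply: le_trans Em.
    rewrite mulrA ler_wpM2r// [(K + 1) * _]mulrC ler_wpM2r; lra.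
  by rewrite ler_pM2l//; lra.
have dE : dotp V.1 V.1 + dotp V.2 V.2 <= E.
  rewrite /E lerD2r ler_peMl ?dotp_ge0//; have := h1 X; lra.
(* [17 / 64 = 1 / 8 + 9 / 64], from Young's inequality with [e = 1 / 8] *)
have hY2 : `|bracketX Y ^+ 2 - bracketX X ^+ 2| <= 17 / 64 * bracketX X ^+ 2.
  have := @bracketX_shift _ _ X V 8^-1 ltac:(lra); rewrite -YE invrK.
  move=> /le_trans; apply; lra.
have hY : 7 / 10 * bracketX X <= bracketX Y <= 13 / 10 * bracketX X.
  move: hY2; rewrite ler_norml => /andP[? ?].
  have hX0 := h1 X; have hY0 := h1 Y.
  by apply/andP; split; rewrite -ler_sqr ?nnegrE ?exprMn; lra.
have aY : `|a Y - a X| <= m X / 4.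
  have k0 : 0 < 8 * c by lra.
  have k1 : `|- (8 * c)^-1| <= 1.
    by rewrite normrN ger0_norm ?invr_ge0 ?(ltW k0)// invf_le1//; lra.
  (* dilating by [8 c] balances the two terms: [|s| c = 1 / 8], while the
     quadratic term becomes [8 c^2 E], at most [m X / 8] *)
  have := var X ((8 * c) *: V) (- (8 * c)^-1) k1.
  have -> : X + - (8 * c)^-1 *: (8 * c *: V) = Y.
    by rewrite scalerA mulNr mulVf ?scaleN1r// gt_eqF//; lra.
  rewrite /= !dotpZ normrN [`|_^-1|]ger0_norm; last by rewrite invr_ge0 ltW.
  move=> /le_trans; apply.
  have -> : (8 * c)^-1 * (c * (a X + bracketX X ^+ 2 * ((8 * c) ^+ 2 * dotp V.1 V.1)
     + (8 * c) ^+ 2 * dotp V.2 V.2)) = a X / 8 + 8 * c ^+ 2 * E.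
    by rewrite /E; field; lra.
  have : a X <= m X by rewrite /m lerDl; have := h1 X; lra.
  by lra.
move: aY hY; rewrite ler_norml => /andP[? ?] /andP[? ?].
have hX0 := h1 X; have aX0 := a0 X; have mX0 := m0 X.
have L : (4 : R) ^+ 3 <= 64 * c ^+ 2 * (K + 1).
  have -> : (4 : R) ^+ 3 = 64 by ring.
  rewrite -mulrA ler_peMr//; nra.
have mE (Z : phase R n) : m Z = a Z + bracketX Z by [].
have mXE := mE X; have mYE := mE Y.
have rXY : bracket_metric m X T / bracket_metric m Y T <= 4 ^+ 3.
  by apply: bracket_metric_ratio => //; lra.
have rYX : bracket_metric m Y T / bracket_metric m X T <= 4 ^+ 3.
  by apply: bracket_metric_ratio => //; lra.
by rewrite invf_div; split; apply: le_trans L.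
Qed.

Lemma EFin_expr_le (R : realType) (r : R) (x : \bar R) (k : nat) :
  0 <= r -> (r%:E <= x)%E -> ((r ^+ k)%:E <= x ^+ k)%E.
Proof.
move=> r0 rx; elim: k => [|k IH]; first by rewrite expr0 expe0.
by rewrite exprS EFinM expeS lee_pmul// lee_fin ?exprn_ge0.
Qed.

(** The exponent [9] is [3 * 3]: the weights and the brackets at [X] and [Y]
    are comparable up to [O(D^3)], and [bracket_metric_ratio] cubes this. *)
Lemma bracket_metric_temperate (R : realType) (n : nat) (a : phase R n -> R)
    (c : R) :
  (forall X, 0 <= a X) -> 1 <= c -> nonneg_variation a c ->
  temperate (bracket_metric (fun X => a X + bracketX X)).
Proof.
move=> a0 c1 var; pose m := fun X : phase R n => a X + bracketX X.
rewrite -/m.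
have h1 := @bracketX_ge1 R n.
have m0 (X : phase R n) : 0 < m X.
  by rewrite /m; have := a0 X; have := h1 X; lra.
exists ((4 * c + 4) ^+ 3); first by rewrite exprn_gt0//; lra.
exists 9%N => X Y T T0.
set V := X - Y.
pose G := diag_dual ((m Y)^-1 * bracketX Y ^+ 2) (m Y)^-1 V.
pose D := 1 + G.
have h0 (Z : phase R n) : 0 < bracketX Z by apply: lt_le_trans (h1 Z).
have A0 : 0 < (m Y)^-1 * bracketX Y ^+ 2.
  by apply: mulr_gt0; rewrite ?invr_gt0 ?exprn_gt0.
have B0 : 0 < (m Y)^-1 by rewrite invr_gt0.
have G0 : 0 <= G.
  by apply: addr_ge0; apply: mulr_ge0; rewrite ?dotp_ge0 ?invr_ge0 ?ltW.
have D1 : 1 <= D by rewrite lerDl.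
have D0 : 0 < D by lra.
have DD : (((4 * c + 4) ^+ 3 * D ^+ 9)%:E <= ((4 * c + 4) ^+ 3)%:E
    * (1 + dual_form (bracket_metric m) Y V) ^+ 9)%E.
  rewrite EFinM lee_wpmul2l//.
    by rewrite lee_fin exprn_ge0//; lra.
  apply: EFin_expr_le; first exact: ltW.
  by rewrite EFinD leeD2l//; apply: diag_dual_le T0 _ _.
pose L := (4 * c + 4) * D ^+ 3.
have L3 : L ^+ 3 = (4 * c + 4) ^+ 3 * D ^+ 9.
  by rewrite /L exprMn -exprM.
pose p := dotp V.1 V.1; pose q := dotp V.2 V.2.
have p0 : 0 <= p := dotp_ge0 _; have q0 : 0 <= q := dotp_ge0 _.
pose EY := bracketX Y ^+ 2 * p + q.
have sqge1 (Z : phase R n) : bracketX Z <= bracketX Z ^+ 2.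
  by rewrite expr2 ler_peMl// ltW.
have GE : m Y * EY = G * bracketX Y ^+ 2.
  rewrite /G /diag_dual -/p -/q /EY; field.
  by rewrite !gt_eqF.
have mYh : bracketX Y <= m Y by rewrite /m lerDr.
(* [EY = G h_Y^2 / m_Y] and [h_Y <= m_Y] *)
have EYh : EY <= G * bracketX Y.
  rewrite -(ler_pM2l (m0 Y)) GE expr2 mulrA [leRHS]mulrC.
  by rewrite ler_wpM2l// mulr_ge0// ltW.
have dE : p + q <= EY.
  by rewrite /EY lerD2r ler_peMl//; have := sqge1 Y; have := h1 Y; lra.
have D2 : 1 <= D ^+ 2 by rewrite exprn_ege1.
have D23 : D ^+ 2 <= D ^+ 3 by rewrite [leRHS]exprS ler_peMl//; lra.
have D12 : D <= D ^+ 2 by rewrite expr2 ler_peMl//; lra.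
have DG : G = D - 1 by rewrite /D; ring.
have YE : Y = X - V by rewrite /V opprB addrC subrK.
have XE : X = Y - - V by rewrite opprK /V addrC subrK.
have dN (n' : nat) (v : 'rV[R]_n') : dotp (- v) (- v) = dotp v v.
  by rewrite -scaleN1r dotpZ; ring.
have hXY2 : bracketX X ^+ 2 <= 2 * D * bracketX Y ^+ 2.
  have := @bracketX_shift _ _ Y (- V) 1 ltr01; rewrite -XE invr1 /= !dN -/p -/q.
  rewrite ler_norml => /andP[_ h].
  have : G * bracketX Y <= G * bracketX Y ^+ 2 by rewrite ler_wpM2l.
  by rewrite DG in EYh *; lra.
have hYX2 : bracketX Y ^+ 2 <= (2 * D * bracketX X) ^+ 2.
  have := @bracketX_shift _ _ X V 1 ltr01; rewrite -YE invr1 -/p -/q.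
  rewrite ler_norml => /andP[_ h].
  (* half of [h_Y^2] is absorbed by the left-hand side of the goal *)
  have h2 : 2 * (G * bracketX Y) <= bracketX Y ^+ 2 / 2 + 2 * G ^+ 2.
    have := sqr_ge0 (bracketX Y - 2 * G); lra.
  have h3 : G ^+ 2 <= G ^+ 2 * bracketX X ^+ 2.
    by rewrite ler_peMr ?sqr_ge0//; have := sqge1 X; have := h1 X; lra.
  have h4 : 0 <= G * bracketX X ^+ 2 by rewrite mulr_ge0// sqr_ge0.
  rewrite /D; lra.
have hYX : bracketX Y <= 2 * D * bracketX X.
  rewrite -ler_sqr ?nnegrE//; rewrite ltW//; do ?apply: mulr_gt0 => //.
have hXY : bracketX X <= 2 * D * bracketX Y.
  rewrite -ler_sqr ?nnegrE; last 2 first.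
  - by rewrite ltW.
  - by rewrite ltW//; do ?apply: mulr_gt0 => //.
  apply: (le_trans hXY2); rewrite exprMn ler_wpM2r ?sqr_ge0// exprMn; lra.
have mXY : m X <= (c + 2) * D * m Y.
  have := @var Y V 1; rewrite normr1 scale1r [Y + V]addrC /V subrK -/V -/p -/q.
  move=> /(_ (lexx _)); rewrite mul1r ler_norml => /andP[_ h].
  have h2 : c * EY <= c * (G * bracketX Y) by rewrite ler_wpM2l//; lra.
  have h3 : 0 <= a Y * ((c + 2) * G) + a Y.
    by rewrite addr_ge0// mulr_ge0// mulr_ge0//; lra.
  have h4 : 0 <= c * bracketX Y by rewrite mulr_ge0 ?ltW//; lra.
  rewrite /m; move: h2 h3 h4 h hXY; rewrite /EY DG => *; lra.
have mYX : m Y <= L * m X.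
  have := @var X (- V) 1; rewrite normr1 scale1r -YE /= !dN -/p -/q.
  move=> /(_ (lexx _)); rewrite mul1r ler_norml => /andP[_ h].
  have h2 : bracketX X ^+ 2 * p + q <= 4 * D ^+ 3 * bracketX X.
    have i1 : bracketX X ^+ 2 * p + q <= 2 * D * EY.
      rewrite /EY mulrDr mulrA lerD//; first by rewrite ler_wpM2r.
      by rewrite ler_peMl//; lra.
    have i2 : 2 * D * EY <= 2 * D * (D * (2 * D * bracketX X)).
      rewrite ler_wpM2l//; first lra.
      apply: (le_trans EYh); apply: ler_pM => //; first by rewrite ltW.
      by rewrite DG; lra.
    lra.
  have h3 : c * (bracketX X ^+ 2 * p + q) <= c * (4 * D ^+ 3 * bracketX X).
    by rewrite ler_wpM2l//; lra.
  have h4 : 0 <= a X * (c * (4 * D ^+ 3 - 1) + (4 * D ^+ 3 - 1)).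
    by rewrite mulr_ge0//; apply: addr_ge0; [apply: mulr_ge0|]; lra.
  have h5 : D * bracketX X <= D ^+ 3 * bracketX X.
    by rewrite ler_wpM2r//; [exact: ltW | lra].
  have h6 : 0 <= D * bracketX X by rewrite mulr_ge0 ?ltW.
  rewrite /L /m; lra.
have cD : D <= D ^+ 3 by lra.
have cc : c * D <= c * D ^+ 3 by rewrite ler_wpM2l//; lra.
have cD0 : 0 <= c * D ^+ 3 by rewrite mulr_ge0//; lra.
have L1 : 1 <= L by rewrite /L; lra.
have L2D : 2 * D <= L by rewrite /L; lra.
have LcD : (c + 2) * D <= L by rewrite /L; lra.
rewrite invf_div; split; apply: le_trans DD; rewrite lee_fin -L3.
  apply: bracket_metric_ratio => //.
  by apply: (le_trans hXY); rewrite ler_wpM2r// ltW.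
apply: bracket_metric_ratio => //.
  by apply: (le_trans mXY); rewrite ler_wpM2r// ltW.
by apply: (le_trans hYX); rewrite ler_wpM2r// ltW.
Qed.

Theorem theorem3p1 (R : realType) (n : nat) (a2 : phase R n -> R)
    (a2_S2 : KN_class 2 a2) (a2_ge0 : forall X, 0 <= a2 X) :
  let a : phase R n -> R := fun X => a2 X + enorm X.1 ^+ 2 in
  let m : phase R n -> R := fun X => a X + bracketX X in
  hormander_metric
    (diag_metric (fun X => (m X)^-1 * (bracket X.2 ^+ 2 + enorm X.1 ^+ 2))
                 (fun X => (m X)^-1)).
Proof.
move=> a m.
have aE : a = (fun X => a2 X + dotp X.1 X.1).
  by apply/funext => X; rewrite /a enorm_sqr.
have [c [K [c1 K1]]] := KN2_nonneg_variation a2_S2 a2_ge0.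
rewrite -aE => var aK'.
have aK X : a X <= K * bracketX X ^+ 2 by rewrite aE.
have a0 X : 0 <= a X by rewrite aE addr_ge0 ?dotp_ge0.
have m_ge X : bracketX X <= m X by rewrite lerDr.
have h0 (X : phase R n) : 0 < bracketX X.
  by apply: lt_le_trans (bracketX_ge1 X).
have m0 X : 0 < m X by apply: lt_le_trans (m_ge X).
have -> : (fun X : phase R n =>
      (m X)^-1 * (bracket X.2 ^+ 2 + enorm X.1 ^+ 2))
    = (fun X => (m X)^-1 * bracketX X ^+ 2).
  apply/funext => X; rewrite bracketX_sqr sqr_sqrtr ?enorm_sqr; last first.
    by rewrite addr_ge0// dotp_ge0.
  by congr (_ * _); ring.
have A0 X : 0 < (m X)^-1 * bracketX X ^+ 2.
  by apply: mulr_gt0; rewrite ?invr_gt0 ?exprn_gt0.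
have B0 X : 0 < (m X)^-1 by rewrite invr_gt0.
split.
- by move=> X; apply: diag_metric_pos_def.
- exact: (bracket_metric_continuous a0 c1 var K1 aK).
- apply: diag_uncertainty => // X.
  have -> : (m X)^-1 * bracketX X ^+ 2 * (m X)^-1 = (bracketX X / m X) ^+ 2.
    by ring.
  by rewrite expr_le1 ?divr_ge0 ?(ltW (h0 _)) ?(ltW (m0 _))// ler_pdivrMr ?mul1r.
- exact: (bracket_metric_temperate a0 c1 var).
Qed.
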